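(* Let $X, Y$ be Banach spaces over $\mathbb{K}$ and let $z \in X \widehat{\otimes}_\pi Y$ with $z = \sum_{n=1}^\infty \lambda_n x_n \otimes y_n$, where $\lambda_n \in \mathbb{R}^+ = (0,\infty)$, $x_n \in S_X$ and $y_n \in S_Y$ for every $n \in \mathbb{N}$. Then the following assertions are equivalent: (1) $\|z\|_\pi = \sum_{n=1}^\infty \lambda_n$ (in other words, $z$ attains its projective norm through the given representation). (2) There is $G \in \mathcal{L}(X, Y^* )$ with $\|G\| = 1$ such that $G(x_n)(y_n) = 1$ for every $n \in \mathbb{N}$. (3) Every $G \in \mathcal{L}(X, Y^* )$ with $\|G\|=1$ and $G(z) = \|z\|_\pi$ satisfies $G(x_n)(y_n) = 1$ for every $n \in \mathbb{N}$.
   Context: $\mathbb{K}$ is $\mathbb{R}$ or $\mathbb{C}$. $S_X$ is the unit sphere of $X$; $\mathcal{L}(X,Z)$ is the space of bounded linear operators with the operator norm. $X \widehat{\otimes}_\pi Y$ is the projective tensor product, the completion of $X \otimes Y$ under $\|z\|_\pi = \inf\{\sum_{n=1}^\infty \|x_n\|\|y_n\| : \sum_{n=1}^\infty \|x_n\|\|y_n\| < \infty,\ z = \sum_{n=1}^\infty x_n \otimes y_n\}$. The series for $z$ converges in $X \widehat{\otimes}_\pi Y$. The dual $(X \widehat{\otimes}_\pi Y)^*$ is isometrically identified with $\mathcal{L}(X, Y^* )$, where $G \in \mathcal{L}(X,Y^* )$ acts by $G(\sum_n u_n \otimes v_n) = \sum_n G(u_n)(v_n)$. An element $z \in X \widehat{\otimes}_\pi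 Y$ attains its projective norm if there is a bounded sequence $(u_n, v_n) \subseteq X \times Y$ with $\sum_n \|u_n\|\|v_n\| < \infty$, $z = \sum_n u_n \otimes v_n$ and $\|z\|_\pi = \sum_n \|u_n\|\|v_n\|$. *)

(* Defs.v *)
From HB Require Import structures.
From mathcomp Require Import all_boot all_order all_algebra sesquilinear.
From mathcomp Require Import complex.
From mathcomp Require Import all_classical all_reals all_analysis.

Set Implicit Arguments.
Unset Strict Implicit.
Unset Printing Implicit Defensive.

Import Order.TTheory GRing.Theory Num.Theory.
Import numFieldNormedType.Exports.

Local Open Scope classical_set_scope.
Local Open Scope ring_scope.

(* Norms over K take their values in K itself, and for K = R[i] the order is
   the partial order in which x <= y means that y - x is a nonnegative real;
   thus 0 < x says that x is a positive real number.  The infima and suprema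
   below are taken for this order, of sets of nonnegative reals. *)
Variant real_or_complex : numFieldType -> Prop :=
  | RealScalars (R : realType) : real_or_complex R
  | ComplexScalars (R : realType) : real_or_complex R[i].

Section BoundedOperators.
Context {K : numFieldType}.

(* The norm of the codomain is an explicit argument, so that the definition
   also applies to operators with values in a dual space. *)
Definition opnorm {V : normedModType K} {W : Type} (normW : W -> K)
    (f : V -> W) : K :=
  supremum 0 [set normW (f v) | v in [set v : V | `|v| <= 1]].

Definition dual_space (Y : normedModType K) : set (Y -> K^o) :=
  [set f | linear f /\ continuous f].

Definition dual_norm {Y : normedModType K} (f : Y -> K^o) : K :=
  opnorm (fun c : K^o => `|c|) f.

(* L(X, Y^* ), its elements being written as curried functions of X and Y *)
Definition L_dual (X Y : normedModType K) : set (X -> Y -> K^o) :=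
  [set G | [/\ linear G, forall x, dual_space (G x) &
               exists M : K, forall x, dual_norm (G x) <= M * `|x|]].

Definition L_dual_norm {X Y : normedModType K} (G : X -> Y -> K^o) : K :=
  opnorm dual_norm G.

End BoundedOperators.

Arguments L_dual {K} X Y _.

Section AlgebraicTensors.
Context {K : numFieldType} {X Y : normedModType K}.

(* The list [:: (x_1, y_1); ...; (x_k, y_k)] stands for the element
   x_1 (x) y_1 + ... + x_k (x) y_k of the algebraic tensor product, and
   [tensor_sum t] evaluates it under a bilinear map t. *)
Definition tensor_sum {V : lmodType K} (t : X -> Y -> V) (s : seq (X * Y)) : V :=
  \sum_(p <- s) t p.1 p.2.

(* Two lists give the same element of the algebraic tensor product iff no
   bilinear map separates them. *)
Definition tensor_eq (s s' : seq (X * Y)) : Prop :=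
  forall (V : lmodType K) (b : {bilinear X -> Y -> V}),
    tensor_sum b s = tensor_sum b s'.

Definition alg_proj_norm (s : seq (X * Y)) : K :=
  infimum 0 [set \sum_(p <- s') `|p.1| * `|p.2| | s' in tensor_eq s].

End AlgebraicTensors.

Section ProjectiveTensorProduct.
Context {K : numFieldType} {X Y : normedModType K}.

(* The Banach space P, with the map t playing the role of (x, y) |-> x (x) y,
   is a completion of the algebraic tensor product of X and Y endowed with
   the projective norm.  This determines (P, t) up to isometric isomorphism. *)
Record is_proj_tensor_product (P : completeNormedModType K)
    (t : {bilinear X -> Y -> P}) : Prop := IsProjTensorProduct {
  proj_tensor_norm : forall s, `|tensor_sum t s| = alg_proj_norm s;
  proj_tensor_dense : dense (range (tensor_sum t)) }.

Context {P : normedModType K}.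
Implicit Types (t : X -> Y -> P) (z : P).

Definition proj_norm t z : K :=
  infimum 0 [set c : K | exists (u : nat -> X) (v : nat -> Y),
    series (fun n => `|u n| * `|v n|) @ \oo --> c /\
    series (fun n => t (u n) (v n)) @ \oo --> z].

(* The action of G on z; its value does not depend on the series that
   represents z. *)
Definition tensor_action t (G : X -> Y -> K^o) z : K^o :=
  xget 0 [set c : K^o | exists (u : nat -> X) (v : nat -> Y),
    series (fun n => t (u n) (v n)) @ \oo --> z /\
    series (fun n => G (u n) (v n)) @ \oo --> c].

End ProjectiveTensorProduct.

(* Main.v *)
Require Import Defs.
From HB Require Import structures.
From mathcomp Require Import all_boot all_order all_algebra sesquilinear.
From mathcomp Require Import complex.
From mathcomp Require Import all_classical all_reals all_analysis.
From mathcomp Require Import ring lra.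

Import Order.TTheory GRing.Theory Num.Theory.
Import numFieldNormedType.Exports.

Local Open Scope classical_set_scope.
Local Open Scope ring_scope.

(** Everything takes place on partial sums of series of elementary tensors.
    For a bounded G and a finite sum s of elementary tensors one has
    |G(s)| <= ||G|| ||s||, because the algebraic projective norm is an infimum
    of costs over all the ways of writing s, and the value of G does not depend
    on the way ([L_dual_tensor_bound]).  Hence G passes to the limit, G(z) does
    not depend on the series used ([L_dual_cvg_unique]), and the representation
    of z gives G(z) = sum_n lambda_n G(x_n)(y_n).

    The second ingredient is that the norm of the completion is the projective
    norm, ||z||_pi = |z| ([proj_norm_eq]).  The inequality |z| <= ||z||_pi is
    the triangle inequality; for the converse, density and the definition of
    the algebraic norm let one approximate z by a finite sum of cost at most
    |z| + eps, then the remainder by a much cheaper one, and so on; the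
    concatenation of these finite sums is a series for z of total cost at most
    |z| + 5 eps.

    Suppose that sum lambda_n = |z|.  By Hahn-Banach there is a functional phi
    on the completion with |phi| <= 1 and phi(z) = |z|; for the operator
    G(x)(y) = phi(x (x) y), the number sum lambda_n = |z| = G(z) is a sum, with
    weights lambda_n > 0, of scalars G(x_n)(y_n) of modulus at most 1, which
    forces all of them to be 1 ([weighted_average_extremal]).  This is the
    second assertion.  It implies the third: an operator equal to 1 at all the
    (x_n, y_n) sends z to sum lambda_n, so that sum lambda_n <= |z|, which is
    then an equality, and the extremality argument applies to each G with
    G(z) = |z|.  Finally assume the third assertion.  If z <> 0, the Hahn-Banach
    operator satisfies its premises, so that |z| = G(z) = sum lambda_n.  If
    z = 0, it is contradictory, since it would apply to an operator of norm 1
    with G(- x_0)(y_0) = 1.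

    The scalars are real or complex and norms take their values in the scalar
    field itself, whose order is only partial in the complex case.  Three facts
    are proved by cases on the field: the reals in it form a complete ordered
    field, so that bounded sets of them have infima and suprema; the extremal
    case of the triangle inequality; and Hahn-Banach. *)

(** * The Hahn-Banach theorem *)

Section HahnBanach.
Context {R : realType} {V : lmodType R} (p : V -> R).
Hypothesis pD : forall u v, p (u + v) <= p u + p v.
Hypothesis pZ : forall (r : R) v, 0 <= r -> p (r *: v) = r * p v.

(** Partial functionals are handled through their graphs, so that extensions
    are inclusions and unions of chains are literal unions.  A linear graph
    below [p] is single-valued: a pair (0, r) in it gives both r <= p 0 = 0 and
    - r <= 0. *)
Definition dominated_graph (A : set (V * R)) : Prop :=
  (forall r a b, A a -> A b -> A (r *: a.1 + b.1, r * a.2 + b.2)) /\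
  (forall a, A a -> a.2 <= p a.1).

Definition graph_line (v0 : V) : set (V * R) :=
  [set (r *: v0, r * p v0) | r in [set: R]].

Lemma sublinear0 : p 0 = 0.
Proof. by rewrite -(scale0r 0) pZ // mul0r. Qed.

Lemma dominated_graph_line v0 : dominated_graph (graph_line v0).
Proof.
split=> [r _ _ [a _ <-] [b _ <-]|_ [r _ <-]] /=.
  by exists (r * a + b) => //; rewrite scalerDl scalerA mulrDl mulrA.
have [r0|/ltW r0] := leP 0 r; first by rewrite pZ.
have := pD (r *: v0) (- r *: v0).
rewrite -scalerDl subrr scale0r sublinear0 (pZ (- r)) ?oppr_ge0 //.
lra.
Qed.

(** The one-dimensional extension step.  The value c at [v] has to satisfy
    a.2 - p (a.1 - v) <= c <= p (b.1 + v) - b.2 for all a and b in the graph;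
    subadditivity of [p] makes the left-hand sides smaller than the right-hand
    ones, and their supremum is chosen. *)
Lemma dominated_graph_extend A v : A (0, 0) -> dominated_graph A ->
  exists c, dominated_graph
    [set x | exists a s, A a /\ x = (a.1 + s *: v, a.2 + s * c)].
Proof.
move=> A0 [Alin Ap].
have AZ r a : A a -> A (r *: a.1, r * a.2).
  by move=> Aa; have := Alin r _ _ Aa A0; rewrite /= !addr0.
pose L : set R := [set a.2 - p (a.1 - v) | a in A].
have Lle a b : A a -> A b -> a.2 - p (a.1 - v) <= p (b.1 + v) - b.2.
  move=> Aa Ab; have := Ap _ (Alin 1 _ _ Aa Ab); rewrite /= scale1r mul1r.
  have := pD (a.1 - v) (b.1 + v).
  have -> : a.1 - v + (b.1 + v) = a.1 + b.1 by rewrite addrACA addNr addr0.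
  lra.
have L0 : L !=set0 by exists (0 - p (0 - v)), (0, 0).
have Lub b : A b -> ubound L (p (b.1 + v) - b.2).
  by move=> Ab _ [a Aa <-]; exact: Lle.
have supL : has_sup L by split=> //; eexists; exact: Lub A0.
exists (sup L).
split=> [r _ _ [a [s [Aa ->]]] [b [s' [Ab ->]]]|_ [a [s [Aa ->]]]] /=.
  exists (r *: a.1 + b.1, r * a.2 + b.2), (r * s + s').
  split; first exact: Alin.
  congr pair; last by rewrite /=; ring.
  by rewrite /= scalerDr addrACA scalerA -scalerDl.
have [s0|s0|->] := ltrgt0P s; last by rewrite scale0r mul0r !addr0; exact: Ap.
- have /(ge_sup L0) : ubound L (p (s^-1 *: a.1 + v) - s^-1 * a.2).
    exact: (Lub _ (AZ s^-1 _ Aa)).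
  rewrite -(ler_pM2l s0) mulrBr -(pZ _ _ (ltW s0)) scalerDr scalerA.
  by rewrite mulrA divff ?gt_eqF // scale1r mul1r; lra.
- have := ub_le_sup supL.2
    (imageP (fun a : V * R => a.2 - p (a.1 - v)) (AZ (- s)^-1 _ Aa)).
  have Ns0 : 0 < - s by rewrite oppr_gt0.
  rewrite /= -(ler_pM2l Ns0) mulrBr -(pZ _ _ (ltW Ns0)) scalerBr scalerA.
  by rewrite mulrA divff ?gt_eqF // scale1r mul1r scaleNr opprK; lra.
Qed.

(** Zorn's lemma applied to the dominated graphs that extend the graph of
    r v0 |-> r p(v0).  The empty graph has to be allowed, as the union of the
    empty chain. *)
Lemma Hahn_Banach (v0 : V) : exists f : V -> R,
  [/\ forall r u v, f (r *: u + v) = r * f u + f v,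
      forall v, f v <= p v & f v0 = p v0].
Proof.
pose P A := dominated_graph A /\ (A !=set0 -> graph_line v0 `<=` A).
have [|A [[[Alin Ap] Aline] Amax]] := @Zorn_bigcup _ P.
  move=> F FP Ftot; split; last first.
    move=> [a [X FX Xa]] b lb; exists X => //.
    by apply: (FP _ FX).2 lb; exists a.
  split=> [r a b [X FX Xa] [Y FY Yb]|a [X FX Xa]]; last exact: (FP _ FX).1.2.
  have [XY|YX] := Ftot _ _ FX FY.
  - by exists Y => //; apply: (FP _ FY).1.1 => //; exact: XY.
  - by exists X => //; apply: (FP _ FX).1.1 => //; exact: YX.
have linev0 : graph_line v0 (v0, p v0).
  by exists 1 => //; rewrite scale1r mul1r.
have lineA : graph_line v0 `<=` A.
  have [//|/nonemptyPn A0] := pselect (A !=set0).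
  exfalso; apply: (Amax (graph_line v0)).
    split; first by rewrite A0.
    by rewrite A0 => /(_ _ linev0).
  by split=> [|_]; [exact: dominated_graph_line|].
have A00 : A (0, 0) by apply: lineA; exists 0 => //; rewrite scale0r mul0r.
have Atot v : exists r, A (v, r).
  have [c gc] := dominated_graph_extend A v A00 (conj Alin Ap).
  set B := (X in dominated_graph X) in gc.
  have AB : A `<=` B.
    by move=> [u r] Aa; exists (u, r), 0; rewrite scale0r mul0r !addr0.
  have Bvc : B (v, c).
    by exists (0, 0), 1; rewrite scale1r mul1r !add0r.
  exists c; apply: contrapT => nA; apply: (Amax B).
    by split=> // BA; exact/nA/BA.
  by split=> // _ x /lineA /AB.
have Afun v r s : A (v, r) -> A (v, s) -> r = s.
  have H a b : A (v, a) -> A (v, b) -> b <= a.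
    move=> Aa Ab; have := Ap _ (Alin (-1) _ _ Aa Ab).
    by rewrite /= scaleN1r addNr sublinear0 mulN1r addrC subr_le0.
  by move=> Ar As; apply/le_anti; rewrite !H.
have [f fA] := choice Atot; exists f; split.
- by move=> r u v; apply: Afun (fA _) (Alin r _ _ (fA u) (fA v)).
- by move=> v; exact: Ap (fA v).
- by apply: Afun (fA _) _; exact: lineA.
Qed.
End HahnBanach.

Section ComplexAsReal.
Local Open Scope complex_scope.
Context {R : realType}.

(** Restriction of scalars from the complex to the real numbers.  The alias
    keeps inference from confusing the two module structures. *)
Definition real_lmod (V : Type) : Type := V.
Definition real_scale {V : lmodType R[i]} (r : R) (v : real_lmod V) :
  real_lmod V := r%:C *: (v : V).

HB.instance Definition _ (V : lmodType R[i]) := GRing.Zmodule.on (real_lmod V).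

Fact real_scaleA (V : lmodType R[i]) r s (v : real_lmod V) :
  real_scale r (real_scale s v) = real_scale (r * s) v.
Proof. by rewrite /real_scale scalerA -rmorphM. Qed.
Fact real_scale1 (V : lmodType R[i]) : left_id 1 (@real_scale V).
Proof. by move=> v; exact: scale1r. Qed.
Fact real_scaleDr (V : lmodType R[i]) : right_distributive (@real_scale V) +%R.
Proof. by move=> r u v; exact: scalerDr. Qed.
Fact real_scaleDl (V : lmodType R[i]) v :
  {morph (@real_scale V)^~ v : r s / r + s}.
Proof. by move=> r s; rewrite /real_scale rmorphD scalerDl. Qed.

HB.instance Definition _ (V : lmodType R[i]) :=
  GRing.Zmodule_isLmodule.Build R (real_lmod V)
    (@real_scaleA V) (@real_scale1 V) (@real_scaleDr V) (@real_scaleDl V).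

End ComplexAsReal.

Section Extremality.
Context {K : numFieldType} (hK : real_or_complex K).

(** Equality throughout alpha + beta = |a + b| <= |a| + |b| <= alpha + beta.  In
    the complex case a and b then have the same argument, which is that of their
    sum, hence zero. *)
Lemma norm_add_extremal (a b alpha beta : K) :
  `|a| <= alpha -> `|b| <= beta -> 0 < alpha ->
  a + b = alpha + beta -> a = alpha.
Proof.
case: hK a b alpha beta => R a b al be ha hb al0 e.
  have := ler_norm a; have := ler_norm b; lra.
have h : `|a| + `|b| = al + be.
  apply/le_anti; rewrite lerD //= (le_trans _ (ler_normD _ _)) // e.
  apply: real_ler_norm; apply: realD; first exact: gtr0_real.
  exact: ger0_real (le_trans (normr_ge0 _) hb).
have ea : `|a| = al.
  apply/le_anti; rewrite ha /= -(lerD2r be) -h lerD2l //.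
have s0 : 0 < al + be.
  by rewrite ltr_wpDr // (le_trans _ hb).
have /normCDeq[t _ [ta tb]] : `|a + b| = `|a| + `|b| by rewrite e h gtr0_norm.
have : (`|a| + `|b|) * t = al + be by rewrite mulrDl -ta -tb.
rewrite h => /(canRL (mulKf (lt0r_neq0 s0))); rewrite mulVf ?gt_eqF // => t1.
by rewrite ta t1 ea mulr1.
Qed.

End Extremality.

Section NormingFunctional.
Local Open Scope complex_scope.
Context {K : numFieldType} (hK : real_or_complex K).

(** In the complex case, a real-linear h below the norm is the real part of the
    complex-linear f(v) = h(v) - i h(i v).  Rotating v so that f(v) becomes
    nonnegative transfers the bound from h to f. *)
Lemma norming_functional (V : normedModType K) (v0 : V) : exists f : V -> K^o,
  [/\ linear f, forall v, `|f v| <= `|v| & f v0 = `|v0|].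
Proof.
case: hK V v0 => R V v0.
  have [//|r v r0|f [flin fle fv0]] := @Hahn_Banach R V (fun v => `|v|) _ _ v0.
  - exact: ler_normD.
  - by rewrite normrZ ger0_norm.
  - exists f; split=> // v; rewrite ler_norml fle andbT lerNl.
    have := flin (-1) v 0; have := flin 1 0 0; have := fle (- v).
    by rewrite normrN scale1r scaleN1r !addr0; lra.
pose p (v : real_lmod V) : R := complex.Re `|v : V|.
have pE (v : V) : `|v| = (p v)%:C by rewrite /p RRe_real // normr_real.
have [u v|r v r0|h [hlin hle hv0]] := @Hahn_Banach R (real_lmod V) p _ _ v0.
- by rewrite -lecR rmorphD /= -!pE; exact: ler_normD.
- by apply: complexI; rewrite rmorphM /= -!pE /= normrZ ger0_norm ?ler0c.
have hD u v : h (u + v) = h u + h v by rewrite -(scale1r u) hlin mul1r scale1r.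
have h0 : h 0 = 0 by apply: (addrI (h 0)); rewrite -hD !addr0.
have hZ r (v : V) : h (r%:C *: v) = r * h v.
  by have := hlin r v 0; rewrite !addr0 h0 addr0.
have hN v : h (- v) = - h v by apply: (addrI (h v)); rewrite -hD !subrr.
pose f (v : V) : R[i] := h v +i* - h ('i%C *: v).
have fD u v : f (u + v) = f u + f v.
  by rewrite /f scalerDr !hD; simpc; congr (_ +i* _); ring.
have fZ k v : f (k *: v) = k * f v.
  have fr (r : R) w : f (r%:C *: w) = r%:C * f w.
    by rewrite /f scalerA mulrC -scalerA !hZ; simpc.
  have fi w : f ('i%C *: w) = 'i%C * f w.
    rewrite /f scalerA -expr2 sqr_i scaleN1r hN.
    by simpc.
  by rewrite (complexE k) scalerDl -scalerA fD fi !fr mulrDl mulrA.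
have fle v : `|f v| <= `|v|.
  have [->|fv0] := eqVneq (f v) 0; first by rewrite normr0.
  pose th := `|f v| / f v.
  have th1 : `|th| = 1 by rewrite normrM normfV normr_id divff // normr_eq0.
  have : h (th *: v) <= p (th *: v) by exact: hle.
  rewrite -lecR -pE normrZ th1 mul1r.
  congr (_ <= _).
  have : f (th *: v) = `|f v| by rewrite fZ /th mulfVK.
  by move=> e; rewrite -[h _]/(complex.Re (f _)) e RRe_real // normr_real.
exists f; split=> //; first by move=> k u v; rewrite fD fZ.
(* The real part of f(v0) is |v0| and its modulus is at most |v0|: apply the
   extremal case to f(v0) and its conjugate. *)
have c2 : f v0 + (f v0)^* = `|v0| + `|v0|.
  by rewrite addcJ /= hv0 -pE; ring.
have [z0|z0] := eqVneq `|v0| 0.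
  by apply/eqP; rewrite z0 -normr_le0 -z0.
apply: (norm_add_extremal (ComplexScalars R)) c2 => //.
  by rewrite normcJ.
by rewrite lt_def z0 /=.
Qed.
End NormingFunctional.

(** * Order and limits in the scalar field *)

Section Suprema.
Local Open Scope complex_scope.
Context {K : numFieldType} (hK : real_or_complex K).
Implicit Types (A : set K) (a c M eps : K).

(** The real elements of K form a copy of a complete ordered field; this is how
    infima and suprema reach the partially ordered K. *)
Lemma real_embedding : exists (R : realType) (e : {rmorphism R -> K}),
  {mono e : x y / x <= y} /\ forall a, a \is Num.real -> exists r, a = e r.
Proof.
case: hK => R; first by exists R, idfun; split=> // a _; exists a.
exists R, (real_complex R); split=> [x y|a]; first exact: lecR.
by move=> /complex_realP.
Qed.

Lemma infimums_nonneg A : A !=set0 -> (forall a, A a -> 0 <= a) ->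
  infimums A !=set0.
Proof.
have [R [e [eM eR]]] := real_embedding.
move=> [a0 Aa0] A0.
have eK a : 0 <= a -> exists r, a = e r by move=> /ger0_real; exact: eR.
have [r0 a0E] := eK _ (A0 _ Aa0).
pose B : set R := [set r | A (e r)].
have Binf : has_inf B.
  split; first by exists r0; rewrite /B /= -a0E.
  by exists 0 => r Br; rewrite -eM rmorph0; exact: A0.
exists (e (inf B)); split=> [a Aa|c cA].
  have [r ar] := eK _ (A0 _ Aa).
  by rewrite ar eM; apply: (ge_inf Binf.2); rewrite /B /= -ar.
(* A lower bound of a set of reals is comparable to a real, hence real. *)
have cr : c \is Num.real.
  by rewrite (ler_real (cA _ Aa0)) ger0_real // A0.
have [s cs] := eR _ cr; rewrite cs eM; apply: lb_le_inf; first exact: Binf.1.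
by move=> r Br; rewrite -eM -cs; exact: cA.
Qed.

Lemma supremums_nonneg A M :
  A !=set0 -> (forall a, A a -> 0 <= a <= M) ->
  supremums A !=set0.
Proof.
move=> [a0 Aa0] AM.
have [||m [mub mlb]] := infimums_nonneg (ubound A).
- by exists M => a /AM/andP[].
- by move=> c cA; apply: le_trans (cA _ Aa0); case/andP: (AM _ Aa0).
exists m; split=> //.
by move=> a Aa; apply: mlb => c; apply.
Qed.

Lemma infimum_le A a : (forall a, A a -> 0 <= a) -> A a -> infimum 0 A <= a.
Proof.
move=> A0 Aa; have An : A !=set0 by exists a.
rewrite /infimum ifF; last by apply/negbTE/set0P.
have [m mA] := infimums_nonneg A An A0.
by case: xgetP => [y _ [yA _]|/(_ m)//]; exact: yA.
Qed.

Lemma le_infimum A c : A !=set0 -> (forall a, A a -> 0 <= a) ->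
  (forall a, A a -> c <= a) -> c <= infimum 0 A.
Proof.
move=> An A0 cA.
rewrite /infimum ifF; last by apply/negbTE/set0P.
have [m mA] := infimums_nonneg A An A0.
by case: xgetP => [y _ [_ yA]|/(_ m)//]; apply: yA.
Qed.

Lemma infimum_ge0 A :
  A !=set0 -> (forall a, A a -> 0 <= a) -> 0 <= infimum 0 A.
Proof. by move=> An A0; exact: le_infimum. Qed.

Lemma infimum_adherent A eps : A !=set0 -> (forall a, A a -> 0 <= a) ->
  0 < eps -> exists2 a, A a & a < infimum 0 A + eps.
Proof.
move=> An A0 eps0; apply: contrapT => nA.
have : infimum 0 A + eps <= infimum 0 A.
  apply: le_infimum => // a Aa; rewrite real_leNgt.
  - by apply/negP => lt_a; apply: nA; exists a.
  - by apply: ger0_real; rewrite addr_ge0 ?infimum_ge0 // ltW.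
  - exact/ger0_real/A0.
by rewrite gerDl => /(lt_le_trans eps0); rewrite ltxx.
Qed.

Lemma le_supremum A M a : (forall a, A a -> 0 <= a <= M) -> A a ->
  a <= supremum 0 A.
Proof.
move=> AM Aa; have An : A !=set0 by exists a.
rewrite /supremum ifF; last by apply/negbTE/set0P.
have [m mA] := supremums_nonneg A M An AM.
by case: xgetP => [y _ [yA _]|/(_ m)//]; exact: yA.
Qed.

Lemma supremum_le A M : A !=set0 -> (forall a, A a -> 0 <= a <= M) ->
  supremum 0 A <= M.
Proof.
move=> An AM.
rewrite /supremum ifF; last by apply/negbTE/set0P.
have [m mA] := supremums_nonneg A M An AM.
case: xgetP => [y _ [_ yA]|/(_ m)//]; apply: yA.
by move=> a /AM/andP[].
Qed.

End Suprema.

Section Limits.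
Context {K : numFieldType}.
Implicit Types (u : nat -> K) (l b : K).

(** The order of K being partial, nonnegativity is expressed as |u| = u, an
    equation that passes to the limit. *)
Lemma cvgn_ge0 u l : (forall n, 0 <= u n) -> u @ \oo --> l -> 0 <= l.
Proof.
move=> u0 ul; rewrite -[l](_ : `|l| = l) //.
have ul' : u @ \oo --> `|l|.
  have -> : u = fun n => `|u n| by apply/funext => n; rewrite ger0_norm.
  exact: cvg_norm.
exact: norm_cvg_unique ul' ul.
Qed.

Lemma cvgn_le u v l m :
  (forall n, u n <= v n) -> u @ \oo --> l -> v @ \oo --> m -> l <= m.
Proof.
move=> uv ul vm; rewrite -subr_ge0; apply: (@cvgn_ge0 (v \- u)).
  by move=> n; rewrite /= subr_ge0.
exact: cvgB.
Qed.

Lemma nondecreasing_le_cvgn u l : nondecreasing_seq u -> u @ \oo --> l ->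
  forall n, u n <= l.
Proof.
move=> und ul n; apply: (@cvgn_le (fun=> u n) (fun k => u (k + n)%N)).
- by move=> k; apply: und; exact: leq_addl.
- exact: cvg_cst.
- by rewrite cvg_shiftn.
Qed.

Lemma nondecreasing_cvgn_bounded (hK : real_or_complex K) u M :
  nondecreasing_seq u -> (forall n, 0 <= u n <= M) ->
  exists2 l, u @ \oo --> l & l <= M.
Proof.
move=> und uM; pose A := range u.
have AM a : A a -> 0 <= a <= M by move=> [n _ <-].
have An : A !=set0 by exists (u 0%N), 0%N.
have uA n : A (u n) by exists n.
exists (supremum 0 A); last exact: supremum_le.
apply/cvgrPdist_lt => eps eps0.
have [n un] : exists n, supremum 0 A - eps < u n.
  apply: contrapT => nA; have : supremum 0 A <= supremum 0 A - eps.
    have s0 : 0 <= supremum 0 A.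
      apply: le_trans (le_supremum hK _ _ _ AM (uA 0%N)).
      by case/andP: (uM 0%N).
    have h n : u n <= supremum 0 A - eps.
      rewrite real_leNgt; first by apply/negP => lt_n; apply: nA; exists n.
        by apply: ger0_real; case/andP: (uM n).
      by rewrite realB ?ger0_real // ltW.
    apply: supremum_le => // _ [n _ <-]; rewrite h.
    by case/andP: (uM n) => ->.
  by rewrite lerBrDr gerDl => /(lt_le_trans eps0); rewrite ltxx.
exists n => // m /= nm.
rewrite ger0_norm ?subr_ge0; last exact: le_supremum AM _.
by rewrite ltrBlDr -ltrBlDl (lt_le_trans un) // und.
Qed.

End Limits.

Lemma cvg0_dominated {K : numFieldType} {V W : normedModType K}
    (M : K) (u : nat -> V) (v : nat -> W) :
  (forall n, `|v n| <= M * `|u n|) -> u @ \oo --> 0 -> v @ \oo --> 0.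
Proof.
move=> vu u0; apply: norm_cvg0.
have Mu : M * `|u n| @[n --> \oo] --> (0 : K^o).
  by rewrite -(mulr0 M) -(normr0 V); exact: (cvgM (cvg_cst M) (cvg_norm u0)).
apply/cvgrPdist_lt => eps eps0; move/cvgrPdist_lt: Mu => /(_ _ eps0).
apply: filterS => n; rewrite !sub0r !normrN normr_id; apply: le_lt_trans.
apply: le_trans (vu n) (real_ler_norm _).
by rewrite ger0_real // (le_trans _ (vu n)).
Qed.

(** The powers of 1/2 decrease, so they converge, and their limit is half of
    itself. *)
Lemma cvg_expr_half {K : numFieldType} : real_or_complex K ->
  (2^-1 : K) ^+ n @[n --> \oo] --> (0 : K^o).
Proof.
move=> hK; pose a n : K := 2^-1 ^+ n.
have a0 n : 0 <= a n by rewrite exprn_ge0 // invr_ge0.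
have aS n : a n.+1 = 2^-1 * a n by rewrite /a exprS.
have h1 : (2^-1 : K) <= 1 by rewrite invf_le1 // ler1n.
have [||l al _] := @nondecreasing_cvgn_bounded _ hK (fun n => 1 - a n) 1.
- by apply/nondecreasing_seqP => n; rewrite lerD2l lerN2 aS ler_piMl.
- by move=> n; rewrite subr_ge0 gerBl a0 andbT exprn_ile1 // invr_ge0.
have am : a @ \oo --> ((1 - l) : K^o).
  have -> : a = fun n => 1 - (1 - a n) by apply/funext => n; rewrite subKr.
  exact: cvgB (cvg_cst _) al.
have am2 : a @ \oo --> (2^-1 * (1 - l) : K^o).
  rewrite -(cvg_shiftn 1).
  have -> : (fun n => a (n + 1)%N) = fun n => 2^-1 * a n.
    by apply/funext => n; rewrite addn1 aS.
  exact: cvgM (cvg_cst _) am.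
have e : 2^-1 * (1 - l) = 1 - l by exact: norm_cvg_unique am2 am.
have l0 : 1 - l = 0.
  have : 2^-1 * (1 - l) = 0.
    transitivity ((1 - l) - 2^-1 * (1 - l)); first by field.
    by rewrite e subrr.
  by move/eqP; rewrite mulf_eq0 invr_eq0 pnatr_eq0 /= => /eqP.
by rewrite l0 in am.
Qed.


(** Isolate the k-th term: L = lambda_k g_k + (L - lambda_k g_k), where the
    first summand has modulus at most lambda_k and the second one, being the
    sum of the other terms, at most L - lambda_k. *)
Lemma weighted_average_extremal {K : numFieldType} (hK : real_or_complex K)
    (lambda g : nat -> K) (L : K) :
  (forall n, 0 < lambda n) -> (forall n, `|g n| <= 1) ->
  series lambda @ \oo --> L ->
  series (fun n => lambda n * g n) @ \oo --> L -> forall n, g n = 1.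
Proof.
move=> lam0 g1 lamL gL k.
have lamk : lambda k * g k = lambda k.
  apply: (norm_add_extremal hK _ (L - lambda k * g k) _ (L - lambda k)) => //.
  - by rewrite normrM gtr0_norm // ler_piMr // ltW.
  - apply: (@cvgn_le _
        (fun n => `|series (fun n => lambda n * g n) (n + k.+1)%N
                    - lambda k * g k|)
        (fun n => series lambda (n + k.+1)%N - lambda k)).
    + move=> n; rewrite !seriesEord /=.
      have kn : (k < n + k.+1)%N by rewrite addnS ltnS leq_addl.
      rewrite (bigD1 (Ordinal kn)) //=.
      rewrite [X in _ <= X - _](bigD1 (Ordinal kn)) //=.
      rewrite [X in `|X|]addrAC subrr add0r [leRHS]addrAC subrr add0r.
      apply: le_trans (ler_norm_sum _ _ _) _; apply: ler_sum => i _.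
      by rewrite normrM gtr0_norm // ler_piMr // ltW.
    + apply: cvg_norm; apply: cvgB; last exact: cvg_cst.
      by rewrite (cvg_shiftn k.+1 (series (fun n => lambda n * g n))).
    + apply: cvgB; last exact: cvg_cst.
      by rewrite (cvg_shiftn k.+1 (series lambda)).
  - by rewrite addrC subrK addrC subrK.
by apply: (mulfI (lt0r_neq0 (lam0 k))); rewrite mulr1.
Qed.

(** * Operators with values in a dual space *)

Section OperatorNorm.
Context {K : numFieldType} (hK : real_or_complex K).
Context {V : normedModType K} {W : Type} (normW : W -> K).
Context (f : V -> W) (M : K).
Hypothesis (M0 : 0 <= M) (f0 : forall v, 0 <= normW (f v))
  (fM : forall v, normW (f v) <= M * `|v|).

Let opnorm_set := [set normW (f v) | v in [set v : V | `|v| <= 1]].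

Let opnorm_set_bound a : opnorm_set a -> 0 <= a <= M.
Proof.
by move=> [v v1 <-]; rewrite f0 (le_trans (fM v)) // ler_piMr.
Qed.

Lemma opnorm_le : opnorm normW f <= M.
Proof.
apply: supremum_le => //.
by exists (normW (f 0)), 0 => //=; rewrite normr0.
Qed.

Lemma opnorm_ge0 : 0 <= opnorm normW f.
Proof.
apply: le_trans (f0 0) _; apply: (le_supremum hK _ M) => //.
by exists 0 => //=; rewrite normr0.
Qed.

(** [normW] and [f] are arbitrary, so the homogeneity that reduces the bound to
    the unit ball, through v = |v| (v / |v|), is a hypothesis. *)
Lemma le_opnorm : (forall k v, normW (f (k *: v)) <= `|k| * normW (f v)) ->
  forall v, normW (f v) <= opnorm normW f * `|v|.
Proof.
move=> fZ v; have [->|v0] := eqVneq v 0.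
  by rewrite normr0 mulr0; have := fM 0; rewrite normr0 mulr0.
have nv0 : 0 < `|v| by rewrite normr_gt0.
rewrite -ler_pdivrMr // mulrC.
have := fZ (`|v|) (`|v|^-1 *: v).
rewrite scalerA divff ?gt_eqF // scale1r normr_id -ler_pdivrMl //.
move=> /le_trans; apply.
apply: (le_supremum hK _ M) => //.
exists (`|v|^-1 *: v) => //=.
by rewrite normrZ normfV normr_id mulVf // gt_eqF.
Qed.

End OperatorNorm.

Section DualSpaces.
Context {K : numFieldType} (hK : real_or_complex K).

Lemma dual_space_bounded {Y : normedModType K} (f : Y -> K^o) : dual_space f ->
  exists2 M, 0 <= M & forall y, `|f y| <= M * `|y|.
Proof.
move=> [flin fcont].
pose g : {linear Y -> K^o} := HB.pack f (GRing.isLinear.Build _ _ _ _ f flin).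
have /linear_boundedP /pinfty_ex_gt0[M M0 fM] : bounded_near g (nbhs (0 : Y)).
  by apply: continuous_linear_bounded; exact: fcont.
by exists M => //; exact: ltW.
Qed.

Lemma dual_norm_ge0 {Y : normedModType K} (f : Y -> K^o) : dual_space f ->
  0 <= dual_norm f.
Proof. by move=> /dual_space_bounded[M M0 fM]; exact: opnorm_ge0 fM. Qed.

Lemma dual_norm_bound {Y : normedModType K} (f : Y -> K^o) : dual_space f ->
  forall y, `|f y| <= dual_norm f * `|y|.
Proof.
move=> fY; have [M M0 fM] := dual_space_bounded _ fY.
apply: (le_opnorm hK _ _ _ M0 _ fM) => // k y.
case: fY => flin _.
pose g : {linear Y -> K^o} := HB.pack f (GRing.isLinear.Build _ _ _ _ f flin).
have -> : f (k *: y) = k *: f y by exact: (linearZ_LR g).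
by rewrite normrZ.
Qed.

Lemma dual_space_of_bound {Y : normedModType K} (f : Y -> K^o) (M : K) :
  0 <= M -> linear f -> (forall y, `|f y| <= M * `|y|) -> dual_space f.
Proof.
move=> M0 flin fM; split=> //.
pose g : {linear Y -> K^o} := HB.pack f (GRing.isLinear.Build _ _ _ _ f flin).
apply: (@bounded_linear_continuous _ _ _ g); apply/bounded_funP => r.
by exists (M * r) => y yr; apply: le_trans (fM y) _; exact: ler_wpM2l.
Qed.

Context {X Y : normedModType K}.
Implicit Types G : X -> Y -> K^o.

Let dual_norm_lin_le (f : Y -> K^o) (k : K) : dual_space f ->
  dual_norm (k *: f) <= `|k| * dual_norm f.
Proof.
move=> fY; apply: (opnorm_le hK) => //.
  by rewrite mulr_ge0 // dual_norm_ge0.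
by move=> y; rewrite normrZ -mulrA ler_wpM2l // dual_norm_bound.
Qed.

(* In L_dual the constant M may fail to be real when X is trivial; its modulus
   is then as good. *)
Let L_dual_bounded G : L_dual X Y G ->
  exists2 M, 0 <= M & forall x, dual_norm (G x) <= M * `|x|.
Proof.
move=> [_ GY [M GM]]; exists `|M| => // x.
have d0 := dual_norm_ge0 _ (GY x).
by have := GM x; rewrite -[leRHS]ger0_norm ?(le_trans d0) // normrM normr_id.
Qed.

Lemma L_dual_norm_ge0 G : L_dual X Y G -> 0 <= L_dual_norm G.
Proof.
move=> GL; have [M M0 GM] := L_dual_bounded _ GL.
by apply: opnorm_ge0 GM => // x; apply: dual_norm_ge0; case: GL.
Qed.

Lemma L_dual_norm_bound G : L_dual X Y G ->
  forall x y, `|G x y| <= L_dual_norm G * `|x| * `|y|.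
Proof.
move=> GL x y; have [M M0 GM] := L_dual_bounded _ GL.
have [Glin GY _] := GL.
apply: le_trans (dual_norm_bound _ (GY x) y) _; rewrite ler_wpM2r //.
apply: (le_opnorm hK _ _ _ M0 _ GM) => [u|k u]; first exact: dual_norm_ge0.
have -> : G (k *: u) = k *: G u.
  pose g : {linear X -> (Y -> K^o)} :=
    HB.pack G (GRing.isLinear.Build _ _ _ _ G Glin).
  exact: (linearZ_LR g).
exact: dual_norm_lin_le.
Qed.

Lemma L_dual_of_bound G (M : K) :
  0 <= M -> linear G -> (forall x, linear (G x)) ->
  (forall x y, `|G x y| <= M * `|x| * `|y|) ->
  L_dual X Y G /\ L_dual_norm G <= M.
Proof.
move=> M0 Glin Gxlin GM.
have Mx x : 0 <= M * `|x| by rewrite mulr_ge0.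
have GY x : dual_space (G x) by apply: dual_space_of_bound (GM x).
have Gx x : dual_norm (G x) <= M * `|x| by exact: (opnorm_le hK) (GM x).
split; first by split=> //; exists M.
by apply: (opnorm_le hK) => // x; exact: dual_norm_ge0.
Qed.

End DualSpaces.

(** * The projective norm of finite sums *)

Section Cost.
Context {K : numFieldType} {X Y : normedModType K}.
Implicit Types s : seq (X * Y).

Definition cost s : K := \sum_(p <- s) `|p.1| * `|p.2|.

Lemma cost_ge0 s : 0 <= cost s.
Proof. by apply: sumr_ge0 => p _; rewrite mulr_ge0. Qed.

Lemma cost_cat s s' : cost (s ++ s') = cost s + cost s'.
Proof. exact: big_cat. Qed.

Lemma tensor_sum_cat {V : lmodType K} (t : X -> Y -> V) s s' :
  tensor_sum t (s ++ s') = tensor_sum t s + tensor_sum t s'.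
Proof. exact: big_cat. Qed.

Definition tensor_opp s := [seq (- p.1, p.2) | p <- s].

Lemma tensor_sum_opp {V : lmodType K} (t : {bilinear X -> Y -> V}) s :
  tensor_sum t (tensor_opp s) = - tensor_sum t s.
Proof.
rewrite /tensor_sum big_map -sumrN; apply: eq_bigr => p _ /=.
exact: linearNl.
Qed.

Lemma tensor_sum_mkseq {V : lmodType K} (t : X -> Y -> V) (w : nat -> X * Y) n :
  tensor_sum t (mkseq w n) = series (fun k => t (w k).1 (w k).2) n.
Proof. by rewrite /tensor_sum big_map seriesEnat /= /index_iota subn0. Qed.

Lemma cost_mkseq (w : nat -> X * Y) n :
  cost (mkseq w n) = series (fun k => `|(w k).1| * `|(w k).2|) n.
Proof. by rewrite /cost big_map seriesEnat /= /index_iota subn0. Qed.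

Lemma norm_tensor_sum_le {V : normedModType K} (t : X -> Y -> V) (M : K) s :
  (forall x y, `|t x y| <= M * `|x| * `|y|) -> `|tensor_sum t s| <= M * cost s.
Proof.
move=> tM; rewrite /tensor_sum /cost mulr_sumr.
apply: le_trans (ler_norm_sum _ _ _) _; apply: ler_sum => p _.
by rewrite mulrA.
Qed.

(** Equality of algebraic tensors is tested against bundled bilinear maps. *)
Lemma L_dual_bilinear (G : X -> Y -> K^o) : L_dual X Y G ->
  exists b : {bilinear X -> Y -> K^o}, (b : X -> Y -> K^o) = G.
Proof.
move=> [Glin GY _].
have Gb : bilinear_for *:%R *:%R G.
  split=> [y k x x'|x]; last by case: (GY x).
  by have := Glin k x x' => /(congr1 (fun f => f y)).
pose b : {bilinear X -> Y -> K^o} :=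
  HB.pack G (bilinear_isBilinear.Build _ _ _ _ _ _ G Gb).
by exists b.
Qed.

End Cost.

Section Tensor.
Context {K : numFieldType} (hK : real_or_complex K).
Context {X Y P : completeNormedModType K} (t : {bilinear X -> Y -> P}).
Hypothesis hP : is_proj_tensor_product t.
Implicit Types (s : seq (X * Y)) (z : P).

Let costs s : set K := [set cost s' | s' in tensor_eq s].

Let costs_ge0 s a : costs s a -> 0 <= a.
Proof. by move=> [s' _ <-]; exact: cost_ge0. Qed.

Let costs_neq0 s : costs s !=set0.
Proof. by exists (cost s), s. Qed.

Lemma norm_tensor_sum_le_cost s : `|tensor_sum t s| <= cost s.
Proof.
rewrite (proj_tensor_norm hP).
by apply: (infimum_le hK) => //; [exact: costs_ge0|exists s].
Qed.

Lemma norm_tensor_le (x : X) (y : Y) : `|t x y| <= `|x| * `|y|.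
Proof.
have := norm_tensor_sum_le_cost [:: (x, y)].
by rewrite /tensor_sum /cost !big_seq1.
Qed.

Lemma tensor_sum_approx s (eps : K) : 0 < eps ->
  exists2 s', tensor_eq s s' & cost s' < `|tensor_sum t s| + eps.
Proof.
move=> eps0; rewrite (proj_tensor_norm hP).
have [_ [s' ss' <-] lt_s'] :=
  infimum_adherent hK (costs s) _ (costs_neq0 s) (@costs_ge0 s) eps0.
by exists s'.
Qed.

(** The norm of the tensor is nearly attained as the cost of an equal tensor,
    and [b] takes the same value on it. *)
Lemma tensor_sum_bound {V : normedModType K} (b : {bilinear X -> Y -> V})
    (M : K) s :
  0 <= M -> (forall x y, `|b x y| <= M * `|x| * `|y|) ->
  `|tensor_sum b s| <= M * `|tensor_sum t s|.
Proof.
move=> M0 bM; apply/ler_addgt0Pr => eps eps0.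
have M1 : 0 < M + 1 by rewrite ltr_wpDl.
have [s' ss' lt_s'] := tensor_sum_approx s (eps / (M + 1)) (divr_gt0 eps0 M1).
rewrite (ss' _ b) (le_trans (norm_tensor_sum_le _ _ _ bM)) //.
apply: le_trans (ler_wpM2l M0 (ltW lt_s')) _.
rewrite mulrDr lerD2l mulrA ler_pdivrMr // mulrC ler_wpM2l ?ltW //.
by rewrite ltrDl.
Qed.

Lemma L_dual_tensor_bound (G : X -> Y -> K^o) s : L_dual X Y G ->
  `|tensor_sum G s| <= L_dual_norm G * `|tensor_sum t s|.
Proof.
move=> GL; have [b bG] := L_dual_bilinear G GL.
rewrite -bG; apply: tensor_sum_bound.
- by rewrite bG; exact: L_dual_norm_ge0.
- by rewrite bG; exact: L_dual_norm_bound.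
Qed.

(** The difference of the two partial sums tends to 0 in P, hence so does its
    image under G. *)
Lemma L_dual_cvg_unique (G : X -> Y -> K^o) (z : P) (c : K^o)
  (r r' : nat -> seq (X * Y)) : L_dual X Y G ->
  tensor_sum t (r n) @[n --> \oo] --> z ->
  tensor_sum t (r' n) @[n --> \oo] --> z ->
  tensor_sum G (r n) @[n --> \oo] --> c ->
  tensor_sum G (r' n) @[n --> \oo] --> c.
Proof.
move=> GL rz r'z rc.
have [b bG] := L_dual_bilinear G GL.
have d0 : tensor_sum t (r' n ++ tensor_opp (r n)) @[n --> \oo] --> (0 : P).
  rewrite -(subrr z); under eq_cvg do rewrite tensor_sum_cat tensor_sum_opp.
  exact: cvgB.
have Gd0 : tensor_sum G (r' n ++ tensor_opp (r n)) @[n --> \oo] --> (0 : K^o).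
  apply: cvg0_dominated d0 => n.
  exact: L_dual_tensor_bound.
have -> : (fun n => tensor_sum G (r' n)) =
    (fun n => tensor_sum G (r' n ++ tensor_opp (r n)) + tensor_sum G (r n)).
  by apply/funext => n; rewrite -bG tensor_sum_cat tensor_sum_opp addrNK.
by rewrite -[c]add0r; exact: cvgD.
Qed.

Lemma tensor_action_eq (G : X -> Y -> K^o) (z : P) (c : K^o)
  (u : nat -> X) (v : nat -> Y) : L_dual X Y G ->
  series (fun n => t (u n) (v n)) @ \oo --> z ->
  series (fun n => G (u n) (v n)) @ \oo --> c ->
  tensor_action t G z = c.
Proof.
move=> GL uvz uvc; rewrite /tensor_action.
case: xgetP => [c' _ [u' [v' [z' c'G]]]|/(_ c)]; last by case; exists u, v.
have h (V : lmodType K) (b : X -> Y -> V) (a : nat -> X) (a' : nat -> Y) :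
    series (fun n => b (a n) (a' n)) =
    fun n => tensor_sum b (mkseq (fun k => (a k, a' k)) n).
  by apply/funext => n; rewrite tensor_sum_mkseq.
rewrite !h in uvz uvc z' c'G.
exact: norm_cvg_unique c'G (L_dual_cvg_unique _ _ _ _ _ GL uvz z' uvc).
Qed.

End Tensor.

(** * The norm of the completion as an infimum over series *)

Section Concatenation.
Context {T : Type} (x0 : T) (r : nat -> seq T).

(** The added [x0] makes every block nonempty, so that the first n + 1 blocks
    contain an n-th entry even if some lists [r i] are empty. *)
Definition blocks k : seq T := flatten (mkseq (fun i => x0 :: r i) k).

Definition concat n : T := nth x0 (blocks n.+1) n.

Lemma blocksS k : blocks k.+1 = blocks k ++ x0 :: r k.
Proof. by rewrite /blocks mkseqS flatten_rcons. Qed.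

Lemma size_blocks k : (k <= size (blocks k))%N.
Proof.
elim: k => // k IH; rewrite blocksS size_cat /= addnS ltnS.
exact: leq_trans IH (leq_addr _ _).
Qed.

(** Each [blocks k] is a prefix of the next ones. *)
Lemma nth_blocks k n : (n < size (blocks k))%N ->
  nth x0 (blocks k) n = concat n.
Proof.
have pre a d : exists q, blocks (a + d) = blocks a ++ q.
  elim: d => [|d [q IH]]; first by exists [::]; rewrite addn0 cats0.
  by exists (q ++ x0 :: r (a + d)); rewrite addnS blocksS IH catA.
have nS : (n < size (blocks n.+1))%N by exact: size_blocks.
rewrite /concat => nk.
have [le|/ltnW le] := leqP k n.+1.
  have [q] := pre k (n.+1 - k)%N.
  by rewrite subnKC // => ->; rewrite nth_cat nk.
have [q] := pre n.+1 (k - n.+1)%N.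
by rewrite subnKC // => ->; rewrite nth_cat nS.
Qed.

Lemma mkseq_concat k : mkseq concat (size (blocks k)) = blocks k.
Proof.
apply: (@eq_from_nth _ x0); first by rewrite size_mkseq.
by move=> i; rewrite size_mkseq => ik; rewrite nth_mkseq // nth_blocks.
Qed.

End Concatenation.

Section ProjectiveSeries.
Context {K : numFieldType} (hK : real_or_complex K).
Context {X Y P : completeNormedModType K} (t : {bilinear X -> Y -> P}).
Hypothesis hP : is_proj_tensor_product t.
Implicit Types (s : seq (X * Y)) (z : P).

(** At the ends of the blocks, the partial sums converge to [z] by hypothesis;
    between two ends they move by at most the cost of the entries in between,
    which is a difference of terms of a convergent sequence. *)
Lemma concat_tensor_series (r : nat -> seq (X * Y)) z (M : K) :
  tensor_sum t (flatten (mkseq r k)) @[k --> \oo] --> z ->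
  (forall k, cost (flatten (mkseq r k)) <= M) ->
  exists (w : nat -> X * Y) (c : K),
   [/\ cost (mkseq w n) @[n --> \oo] --> c,
       tensor_sum t (mkseq w n) @[n --> \oo] --> z & c <= M].
Proof.
move=> rz rM; pose x0 : X * Y := (0, 0).
have t0 : t 0 0 = 0 by exact: linear0r.
pose B := blocks x0 r; pose w := concat x0 r.
have TB k : tensor_sum t (B k) = tensor_sum t (flatten (mkseq r k)).
  elim: k => // k IH.
  rewrite /B blocksS mkseqS flatten_rcons !tensor_sum_cat -/(B k) IH.
  by rewrite [tensor_sum t (_ :: _)]big_cons /= t0 add0r.
have CB k : cost (B k) = cost (flatten (mkseq r k)).
  elim: k => // k IH.
  rewrite /B blocksS mkseqS flatten_rcons !cost_cat -/(B k) IH.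
  by rewrite [cost (_ :: _)]big_cons /= normr0 mul0r add0r.
have wD n d : mkseq w (n + d) = mkseq w n ++ [seq w i | i <- iota n d].
  by rewrite /mkseq iotaD map_cat.
have Cnd : nondecreasing_seq (fun n => cost (mkseq w n)).
  by move=> n m /subnKC <-; rewrite wD cost_cat lerDl cost_ge0.
have CM n : 0 <= cost (mkseq w n) <= M.
  rewrite cost_ge0 /= (le_trans (Cnd _ _ (size_blocks x0 r n))) //.
  by rewrite mkseq_concat -/(B n) CB.
have [c wc cM] := nondecreasing_cvgn_bounded hK _ _ Cnd CM.
exists w, c; split=> //.
have Cle := nondecreasing_le_cvgn _ _ Cnd wc.
apply/cvgrPdist_lt => eps eps0; have e2 : 0 < eps / 2 by rewrite divr_gt0.
move/cvgrPdist_lt: rz => /(_ _ e2) [k0 _ hk0].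
move/cvgrPdist_lt: wc => /(_ _ e2) [k1 _ hk1].
pose k := maxn k0 k1; pose N := size (B k).
have kN : (k <= N)%N by exact: size_blocks.
exists N => // n /= /subnKC <-; set d := (n - N)%N.
rewrite (splitr eps) wD tensor_sum_cat opprD addrA.
rewrite (le_lt_trans (ler_normB _ _)) // ltrD //.
  by rewrite mkseq_concat -/(B k) TB; apply: hk0; rewrite /= leq_maxl.
apply: le_lt_trans (hk1 N _); last by rewrite /= (leq_trans _ kN) // leq_maxr.
rewrite ger0_norm ?subr_ge0 //.
apply: le_trans (norm_tensor_sum_le_cost hK _ hP _) _.
by rewrite lerBrDr addrC -cost_cat -wD.
Qed.

Lemma tensor_sum_near z (eps : K) : 0 < eps ->
  exists2 s, cost s <= `|z| + eps & `|z - tensor_sum t s| <= eps.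
Proof.
move=> eps0; have e2 : 0 < eps / 2 by rewrite divr_gt0.
have dns : dense (range (tensor_sum t)) := proj_tensor_dense hP.
have [||x [zx [s _ sx]]] := dns (ball z (eps / 2)).
- by exists z; exact: ballxx.
- exact: ball_open.
move: zx; rewrite -ball_normE /= -sx => zs.
have [s' ss' lt_s'] := tensor_sum_approx hK t hP s _ e2.
exists s'; last first.
  rewrite -(ss' _ t) (le_trans (ltW zs)) // ler_pdivrMr //.
  by rewrite ler_peMr ?ler1n // ltW.
apply: le_trans (ltW lt_s') _; rewrite [in leRHS](splitr eps) addrA lerD2r.
rewrite -lerBlDl (le_trans _ (ltW zs)) // distrC.
apply: le_trans (ler_dist_dist _ _).
by apply: real_ler_norm; rewrite realB ?normr_real.
Qed.

(** Greedy expansion: [rem k] is what remains of [z] after k steps, and the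
    list [r k] approximates it up to [del k] with cost at most |rem k| + del k.
    Since |rem k.+1| <= del k, the costs are summable. *)
Lemma tensor_series_approx z (eps : K) : 0 < eps ->
  exists (w : nat -> X * Y) (c : K),
   [/\ cost (mkseq w n) @[n --> \oo] --> c,
       tensor_sum t (mkseq w n) @[n --> \oo] --> z & c <= `|z| + eps].
Proof.
move=> eps0; pose del k : K := eps / 5 * 2^-1 ^+ k.
have del0 k : 0 < del k by rewrite mulr_gt0 ?divr_gt0 ?exprn_gt0 ?invr_gt0.
have delS k : del k = 2 * del k.+1.
  by rewrite /del exprS; field.
have /choice[pick pickP] : forall p : P * K, exists s, 0 < p.2 ->
    cost s <= `|p.1| + p.2 /\ `|p.1 - tensor_sum t s| <= p.2.
  move=> [p d]; have [d0|nd0] := pselect (0 < d); last by exists [::].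
  by have [s ? ?] := tensor_sum_near p d d0; exists s.
pose rem := fix rem k := if k is k'.+1 then
  rem k' - tensor_sum t (pick (rem k', del k')) else z.
pose r k := pick (rem k, del k).
have [rC rR] : (forall k, cost (r k) <= `|rem k| + del k) /\
    forall k, `|rem k.+1| <= del k.
  by split=> k; have [] := pickP (rem k, del k) (del0 k).
have Tr k : tensor_sum t (flatten (mkseq r k)) = z - rem k.
  elim: k => [|k IH]; first by rewrite subrr /tensor_sum big_nil.
  by rewrite mkseqS flatten_rcons tensor_sum_cat IH /= opprB addrA addrAC.
have rem0 : rem k @[k --> \oo] --> (0 : P).
  rewrite -(cvg_shiftn 1).
  apply: (@cvg0_dominated _ K^o P (eps / 5) _ (fun n => rem (n + 1)%N) _
    (cvg_expr_half hK)) => n.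
  by rewrite addn1 ger0_norm ?exprn_ge0 ?invr_ge0.
apply: (concat_tensor_series r).
  have -> : (fun k => tensor_sum t (flatten (mkseq r k))) =
      (fun k => z - rem k) by exact/funext.
  by rewrite -[X in _ --> X]subr0; exact: (cvgB (cvg_cst z) rem0).
(* With d = del k.+1, one step costs at most del k + d = 3 d and frees
   4 (del k - d) = 4 d; at k = 0 the bound is |z| + 5 del 0 = |z| + eps. *)
have H k : cost (flatten (mkseq r k.+1)) + 4 * del k <= `|z| + eps.
  elim: k => [|k IH].
    rewrite /= cats0; have := rC 0%N.
    rewrite -(lerD2r (4 * del 0%N)) => /le_trans; apply.
    rewrite /= /del expr0 mulr1 -addrA lerD2l [leLHS](_ : _ = eps) //.
    by field.
  apply: le_trans IH; rewrite mkseqS flatten_rcons cost_cat -addrA lerD2l.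
  rewrite (le_trans (lerD (rC _) (lexx _))) //.
  rewrite (le_trans (lerD (lerD (rR _) (lexx _)) (lexx _))) //.
  rewrite (delS k) -subr_ge0 (_ : _ - _ = del k.+1); first exact/ltW.
  by ring.
move=> [|k]; first by rewrite /cost big_nil addr_ge0 // ltW.
by apply: le_trans (H k); rewrite lerDl mulr_ge0 // ltW.
Qed.

End ProjectiveSeries.

Section Projective.
Context {K : numFieldType} (hK : real_or_complex K).
Context {X Y P : completeNormedModType K} (t : {bilinear X -> Y -> P}).
Hypothesis hP : is_proj_tensor_product t.

Lemma proj_norm_eq (z : P) : proj_norm t z = `|z|.
Proof.
rewrite /proj_norm; set A := [set c | _].
have zA c : A c -> `|z| <= c.
  move=> [u [v [uc uz]]]; apply: cvgn_le uc => [n|]; last exact: cvg_norm uz.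
  have := norm_tensor_sum_le_cost hK t hP (mkseq (fun k => (u k, v k)) n).
  by rewrite tensor_sum_mkseq cost_mkseq.
have A0 c : A c -> 0 <= c by move/zA; exact: le_trans.
have approx (eps : K) : 0 < eps -> exists2 c, A c & c <= `|z| + eps.
  move=> eps0.
  have [w [c [wc wz cz]]] := tensor_series_approx hK t hP z eps eps0.
  exists c => //; exists (fst \o w), (snd \o w); split.
    have -> : series (fun n => `|(fst \o w) n| * `|(snd \o w) n|) =
        fun n => cost (mkseq w n).
      by apply/funext => n; rewrite cost_mkseq.
    by [].
  have -> : series (fun n => t ((fst \o w) n) ((snd \o w) n)) =
      fun n => tensor_sum t (mkseq w n).
    by apply/funext => n; rewrite tensor_sum_mkseq.
  by [].
apply/le_anti/andP; split; last first.
  by apply: (le_infimum hK) => //; have [c Ac _] := approx 1 ltr01; exists c.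
apply/ler_addgt0Pr => eps /approx[c Ac cz].
by apply: le_trans cz; exact: (infimum_le hK).
Qed.

Lemma L_dual_comp (phi : P -> K^o) :
  linear phi -> (forall w, `|phi w| <= `|w|) ->
  let G := fun x y => phi (t x y) in L_dual X Y G /\ L_dual_norm G <= 1.
Proof.
move=> phil phi1 G; apply: (L_dual_of_bound hK) => //.
- move=> k x x'; apply/funext => y; rewrite /G.
  have -> : t (k *: x + x') y = k *: t x y + t x' y.
    by rewrite linearDl linearZl_LR.
  exact: phil.
- by move=> x k y y'; rewrite /G linearPr; exact: phil.
- by move=> x y; rewrite mul1r (le_trans (phi1 _)) // (norm_tensor_le hK).
Qed.

(** The product f(u) g(v) of functionals norming x and y. *)
Lemma norming_L_dual (x : X) (y : Y) : `|x| = 1 -> `|y| = 1 ->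
  exists G : X -> Y -> K^o, [/\ L_dual X Y G, L_dual_norm G = 1 & G x y = 1].
Proof.
move=> x1 y1.
have [f [flin f1 fx]] := norming_functional hK X x.
have [g [glin g1 gy]] := norming_functional hK Y y.
pose G (u : X) (v : Y) : K^o := f u * g v.
have Gxy : G x y = 1 by rewrite /G fx gy x1 y1 mulr1.
have [||||GL GM] := L_dual_of_bound hK G 1.
- exact: ler01.
- by move=> k u u'; apply/funext => v; rewrite /G flin mulrDl -mulrA.
- move=> u k v v'; rewrite /G glin mulrDr; congr (_ + _).
  by rewrite mulrCA.
- by move=> u v; rewrite normrM mul1r ler_pM.
exists G; split=> //; apply/le_anti; rewrite GM /=.
by have := L_dual_norm_bound hK G GL x y; rewrite Gxy x1 y1 !mulr1 normr1.
Qed.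

End Projective.

(** * Norm attainment *)

Section Attainment.
Context {K : numFieldType} (hK : real_or_complex K).
Context {X Y P : completeNormedModType K} (t : {bilinear X -> Y -> P}).
Hypothesis hP : is_proj_tensor_product t.
Context (z : P) (lambda : nat -> K) (x : nat -> X) (y : nat -> Y).
Hypothesis hlambda : forall n, 0 < lambda n.
Hypotheses (hx : forall n, `|x n| = 1) (hy : forall n, `|y n| = 1).
Hypothesis hz : series (fun n => lambda n *: t (x n) (y n)) @ \oo --> z.

Let u n := lambda n *: x n.
Let terms n := mkseq (fun k => (u k, y k)) n.

Let tensor_series_cvg : series (fun n => t (u n) (y n)) @ \oo --> z.
Proof.
have -> // : (fun n => t (u n) (y n)) = fun n => lambda n *: t (x n) (y n).
by apply/funext => n; rewrite linearZl_LR.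
Qed.

Let terms_cvg : tensor_sum t (terms n) @[n --> \oo] --> z.
Proof.
have -> // : (fun n => tensor_sum t (terms n)) =
    series (fun n => t (u n) (y n)).
by apply/funext => n; rewrite tensor_sum_mkseq.
Qed.

Let cost_terms n : cost (terms n) = series lambda n.
Proof.
rewrite /terms cost_mkseq; congr (series _ n); apply/funext => k /=.
by rewrite /u normrZ hx hy !mulr1 gtr0_norm.
Qed.

Let L_dual_series (G : X -> Y -> K^o) : L_dual X Y G ->
  series (fun n => G (u n) (y n)) = series (fun n => lambda n * G (x n) (y n)).
Proof.
move=> GL; have [b <-] := L_dual_bilinear G GL.
by congr series; apply/funext => n; rewrite /u linearZl_LR.
Qed.

Let L_dual_terms (G : X -> Y -> K^o) : L_dual X Y G ->
  (fun n => tensor_sum G (terms n)) =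
  series (fun n => lambda n * G (x n) (y n)).
Proof.
by move=> GL; rewrite -L_dual_series //; apply/funext => n;
  rewrite tensor_sum_mkseq.
Qed.

Let L_dual_norm1_le (G : X -> Y -> K^o) : L_dual X Y G -> L_dual_norm G = 1 ->
  forall n, `|G (x n) (y n)| <= 1.
Proof.
move=> GL G1 n; apply: le_trans (L_dual_norm_bound hK G GL _ _) _.
by rewrite G1 hx hy !mulr1.
Qed.

Let series_lambda_nd : nondecreasing_seq (series lambda).
Proof. by apply/nondecreasing_seqP => n; rewrite seriesSr lerDl ltW. Qed.

Lemma attained_norm_gt0 : series lambda @ \oo --> `|z| -> 0 < `|z|.
Proof.
move=> /(nondecreasing_le_cvgn _ _ series_lambda_nd) /(_ 1%N).
by rewrite seriesEnat /= big_nat1; exact: lt_le_trans.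
Qed.

(** The operator is phi(x (x) y), with phi norming z.  Its norm is not smaller
    than 1, since its value at z is |z|. *)
Lemma norming_operator : z != 0 -> exists G : X -> Y -> K^o,
  [/\ L_dual X Y G, L_dual_norm G = 1, tensor_action t G z = `|z| &
      series (fun n => lambda n * G (x n) (y n)) @ \oo --> `|z|].
Proof.
move=> z0; have nz : 0 < `|z| by rewrite normr_gt0.
have [phi [phil phi1 phiz]] := norming_functional hK P z.
have [GL G1] := L_dual_comp hK t hP phi phil phi1.
set G := fun x y => _ in GL G1.
have Gz : series (fun n => G (u n) (y n)) @ \oo --> (`|z| : K^o).
  pose f : {linear P -> K^o} :=
    HB.pack phi (GRing.isLinear.Build _ _ _ _ phi phil).
  have -> : series (fun n => G (u n) (y n)) =
      fun n => phi (series (fun n => t (u n) (y n)) n).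
    apply/funext => n.
    by rewrite !seriesEnat /= /G -[phi]/(f : P -> K^o) linear_sum.
  have [_ phic] : dual_space phi.
    by apply: (dual_space_of_bound phi 1) => // w; rewrite mul1r.
  by rewrite -phiz; exact: (cvg_comp _ _ tensor_series_cvg (phic z)).
have Gact := tensor_action_eq hK t hP G z _ _ _ GL tensor_series_cvg Gz.
rewrite L_dual_series // in Gz.
exists G; split=> //; apply/le_anti; rewrite G1 /=.
rewrite -(ler_pM2r nz) mul1r -[X in X <= _]normr_id.
apply: (@cvgn_le _ (fun n => `|tensor_sum G (terms n)|)
  (fun n => L_dual_norm G * `|tensor_sum t (terms n)|)).
- by move=> n; exact: L_dual_tensor_bound.
- by apply: cvg_norm; rewrite L_dual_terms.
- by apply: cvgM; [exact: cvg_cst|exact: cvg_norm].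
Qed.

(** The operator sends the partial sums of the representation to the partial
    sums of lambda, which are therefore bounded by |z|; conversely, the latter
    are the costs of the former. *)
Lemma attained_of_operator (G : X -> Y -> K^o) :
  L_dual X Y G -> L_dual_norm G = 1 -> (forall n, G (x n) (y n) = 1) ->
  series lambda @ \oo --> `|z|.
Proof.
move=> GL G1 Gxy.
have lam_ge0 n : 0 <= series lambda n by rewrite -cost_terms cost_ge0.
have lam_le n : series lambda n <= `|tensor_sum t (terms n)|.
  have := L_dual_tensor_bound hK t hP G (terms n) GL.
  have -> : tensor_sum G (terms n) = series lambda n.
    rewrite -[LHS]/((fun n => tensor_sum G (terms n)) n) L_dual_terms //.
    by congr (series _ n); apply/funext => k; rewrite Gxy mulr1.
  by rewrite G1 mul1r ger0_norm.
have lam_z n : series lambda n <= `|z|.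
  apply: (@cvgn_le _ (fun=> series lambda n)
    (fun k => `|tensor_sum t (terms (k + n)%N)|)).
  - move=> k; apply: le_trans (lam_le _).
    by apply: series_lambda_nd; exact: leq_addl.
  - exact: cvg_cst.
  - rewrite (cvg_shiftn n (fun k => `|tensor_sum t (terms k)|)).
    exact: cvg_norm.
have [|L lamL Lz] := nondecreasing_cvgn_bounded hK _ `|z| series_lambda_nd.
  by move=> n; rewrite lam_ge0 lam_z.
have zL : `|z| <= L.
  apply: cvgn_le (cvg_norm terms_cvg) lamL => n.
  by rewrite -cost_terms (norm_tensor_sum_le_cost hK).
by have <- : L = `|z| by apply/le_anti; rewrite Lz zL.
Qed.

Lemma operator_of_attained (G : X -> Y -> K^o) :
  series lambda @ \oo --> `|z| -> L_dual X Y G -> L_dual_norm G = 1 ->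
  tensor_action t G z = `|z| -> forall n, G (x n) (y n) = 1.
Proof.
move=> lamz GL G1 Gz.
apply: (weighted_average_extremal hK lambda _ `|z|) => //.
  exact: L_dual_norm1_le.
rewrite -L_dual_terms //; move: Gz; rewrite /tensor_action.
(* The default value 0 of the action is excluded, since |z| > 0. *)
case: xgetP => [c _ [u' [v' [uvz uvc]]] cz|_ z00]; last first.
  by have := attained_norm_gt0 lamz; rewrite -z00 ltxx.
rewrite {}cz in uvc.
apply: (L_dual_cvg_unique hK t hP G z _
  (fun n => mkseq (fun k => (u' k, v' k)) n)) => //.
- by under eq_cvg do rewrite tensor_sum_mkseq.
- by under eq_cvg do rewrite tensor_sum_mkseq.
Qed.

(** Any operator acts on 0 by 0 = |0|, so it suffices to exhibit one of norm 1
    that does not take the value 1 at (x_0, y_0). *)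
Lemma norming_operators_neq0 :
  (forall G : X -> Y -> K^o, L_dual X Y G -> L_dual_norm G = 1 ->
     tensor_action t G z = `|z| -> forall n, G (x n) (y n) = 1) -> z != 0.
Proof.
move=> all1; apply/eqP => z0.
have Nx0 : `|- x 0%N| = 1 by rewrite normrN.
have [G [GL G1 GN]] := norming_L_dual hK _ _ Nx0 (hy 0%N).
have [b bG] := L_dual_bilinear G GL.
have ser0 (V : normedModType K) (v : V) : v = 0 -> series (fun=> v) @ \oo --> 0.
  move=> ->; have -> : series (fun=> 0 : V) = cst 0.
    by apply/funext => n; rewrite seriesEnat /= big1.
  exact: cvg_cst.
have Gact : tensor_action t G z = `|z|.
  rewrite z0 normr0.
  apply: (tensor_action_eq hK t hP G 0 0 (fun=> 0) (fun=> 0) GL).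
    by apply: ser0; rewrite linear0r.
  by apply: ser0; rewrite -bG linear0r.
have := GN; rewrite -bG linearNl bG (all1 G GL G1 Gact) => /eqP.
by rewrite eq_sym -subr_eq0 opprK (pnatr_eq0 K 2).
Qed.

End Attainment.

Theorem theorem3p1 (K : numFieldType) (hK : real_or_complex K)
    (X Y : completeNormedModType K)
    (P : completeNormedModType K) (t : {bilinear X -> Y -> P})
    (hP : is_proj_tensor_product t)
    (z : P) (lambda : nat -> K) (x : nat -> X) (y : nat -> Y)
    (hlambda : forall n, 0 < lambda n)
    (hx : forall n, `|x n| = 1) (hy : forall n, `|y n| = 1)
    (hz : series (fun n => lambda n *: t (x n) (y n)) @ \oo --> z) :
  [<-> series lambda @ \oo --> proj_norm t z;
       exists G : X -> Y -> K^o,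
         [/\ L_dual X Y G, L_dual_norm G = 1 & forall n, G (x n) (y n) = 1];
       forall G : X -> Y -> K^o,
         L_dual X Y G -> L_dual_norm G = 1 ->
         tensor_action t G z = proj_norm t z ->
         forall n, G (x n) (y n) = 1].
Proof.
rewrite proj_norm_eq //; tfae.
- move=> lamz.
  have z0 : z != 0 by rewrite -normr_gt0; exact: attained_norm_gt0 lamz.
  have [G [GL G1 Gz _]] := norming_operator hK t hP z lambda x y hz z0.
  exists G; split=> //.
  by apply: (operator_of_attained hK t hP z lambda x y).
- move=> [G0 [G0L G01 G0xy]] G; apply: operator_of_attained => //.
  by apply: (attained_of_operator hK t hP z lambda x y _ _ _ _ G0).
- move=> all1.
  have z0 : z != 0 by apply: (norming_operators_neq0 hK t hP z x y).
  have [G [GL G1 Gz]] := norming_operator hK t hP z lambda x y hz z0.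
  by under [X in series X]funext do rewrite all1 // mulr1.
Qed.
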